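(* Every bisequential rectifiable space $G$ is metrizable.
   Context: All spaces are assumed to be $T_1$ and regular. A topological space $G$ is a rectifiable space if there are a surjective homeomorphism $\varphi: G\times G\to G\times G$ and an element $e\in G$ such that $\pi_1\circ\varphi=\pi_1$ and $\varphi(x,x)=(x,e)$ for every $x\in G$, where $\pi_1:G\times G\to G$ is the projection to the first coordinate. A family $\zeta$ of non-empty subsets of a space $X$ is a prefilter on $X$ if whenever $P_1,P_2\in\zeta$ there is $P\in\zeta$ with $P\subset P_1\cap P_2$. A prefilter $\zeta$ converges to $x\in X$ if every open neighborhood of $x$ contains an element of $\zeta$; it accumulates to $x$ if $x$ belongs to the closure of every element of $\zeta$. Two prefilters $\zeta,\eta$ are synchronous if $P\cap Q\neq\emptyset$ for all $P\in\zeta$, $Q\in\eta$. A space $X$ is bisequential if for every prefilter $\zeta$ on $X$ accumulating to a point $x\in X$ there exists a countable prefilter $\xi$ on $X$ converging to the same point $x$ such that $\zeta$ and $\xi$ are synchronous. *)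

(* Defs.v *)
From mathcomp Require Import all_boot all_order all_algebra.
From mathcomp Require Import all_classical all_reals topology.

Set Implicit Arguments.
Unset Strict Implicit.
Unset Printing Implicit Defensive.

Local Open Scope classical_set_scope.

Definition homeomorphism (X Y : topologicalType) (f : X -> Y) : Prop :=
  continuous f /\
  exists g : Y -> X, [/\ cancel f g, cancel g f & continuous g].

Definition rectifiable (G : topologicalType) : Prop :=
  exists (phi : G * G -> G * G) (e : G),
    [/\ homeomorphism phi,
        (forall p : G * G, (phi p).1 = p.1) &
        (forall x : G, phi (x, x) = (x, e))].

Definition prefilter (X : Type) (zeta : set (set X)) : Prop :=
  (forall P, zeta P -> P !=set0) /\
  (forall P1 P2, zeta P1 -> zeta P2 ->
     exists2 P, zeta P & P `<=` P1 `&` P2).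

Definition converges_to (X : topologicalType) (zeta : set (set X)) (x : X) :
    Prop :=
  forall U : set X, open_nbhs x U -> exists2 P, zeta P & P `<=` U.

(* The accumulation points of a prefilter. *)
Definition adheres_to (X : topologicalType) (zeta : set (set X)) (x : X) :
    Prop :=
  forall P : set X, zeta P -> closure P x.

(* [meets], written F `#` G, says that every member of F intersects every member
   of G: this is synchronicity of prefilters. *)
Definition bisequential (X : topologicalType) : Prop :=
  forall (zeta : set (set X)) (x : X),
    prefilter zeta -> adheres_to zeta x ->
    exists xi : set (set X),
      [/\ countable xi, prefilter xi, converges_to xi x & zeta `#` xi].

Definition metrizable (R : realType) (X : topologicalType) : Prop :=
  exists (M : metricType R) (f : X -> M), homeomorphism f.

(* Main.v *)
Require Import Defs.
From HB Require Import structures.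
From mathcomp Require Import all_boot all_order all_algebra.
From mathcomp Require Import all_classical all_reals topology.
From mathcomp Require Import normedtype.

(** A rectifiable space carries continuous operations [p] and [q] that behave
    like the multiplication [x y] and the division [x^-1 y] of a topological
    group: [p x] and [q x] are mutually inverse homeomorphisms, and [q x x = e],
    so [p x] carries [e] to [x].  The proof has two halves.

    Bisequentiality gives a countable neighborhood base at [e].  Apply it to the
    prefilter of all dense open sets, which accumulates everywhere.  A set that
    meets every dense open set is somewhere dense, so the resulting countable
    prefilter consists of sets [A] whose closure has non-empty interior; by
    regularity these interiors still converge to [e]
    ([bisequential_pi_sequence]).  As in a group, where [O^-1 O] is a
    neighborhood of the identity for every non-empty open [O], the sets
    [q (O x O)] are then a countable neighborhood base at [e]
    ([neighborhood_sequence_of_pi_sequence]).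

    A countable base [C n] at [e] gives a metric.  Call [x] and [y] [n]-close
    when both [q x y] and [q y x] are in [C n].  This relation is symmetric, and
    since [y = p x (q x y)], the continuity of [p] shows that for each [x] a
    chain of three [m]-close steps starting at [x] stays in any given
    neighborhood of [x] once [m] is large.  How large may depend on [x], so this
    is weaker than a uniformity, but it is enough for Frink's metrization
    theorem ([metrizable_frink]): choosing the index of the neighborhood
    separately at each point makes the condition uniform and produces a
    countable base of a compatible uniformity. *)

Set Implicit Arguments.
Unset Strict Implicit.
Unset Printing Implicit Defensive.

Import Order.TTheory GRing.Theory Num.Theory.
Local Open Scope classical_set_scope.

(** * From countable uniformities to metrics *)

Lemma metricType_of_dist (R : realType) (X : choiceType) (d : X -> X -> R) :
  (forall x, d x x = 0%R) ->
  (forall x y, d x y = 0%R -> x = y) ->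
  (forall x y, d x y = d y x) ->
  (forall y x z, d x z <= d x y + d y z)%R ->
  exists (M : metricType R) (f : X -> M) (g : M -> X),
    [/\ cancel f g, cancel g f & forall x y, mdist (f x) (f y) = d x y].
Proof.
case: X d => T [Tchoice Teq] d /= dxx dpos dsym dtri.
pose Tmetric :=
  @isMetric.Axioms_ R T Tchoice Teq d dxx dpos dsym dtri.
pose M : metricType R := HB.pack T Tchoice Teq Tmetric.
by exists M, id, id.
Qed.

Lemma metrizable_dist (R : realType) (X : topologicalType) (d : X -> X -> R) :
  (forall x, d x x = 0%R) ->
  (forall x y, d x y = 0%R -> x = y) ->
  (forall x y, d x y = d y x) ->
  (forall y x z, d x z <= d x y + d y z)%R ->
  (forall x (U : set X),
     nbhs x U <-> exists2 r : R, (0 < r)%R & forall y, (d x y < r)%R -> U y) ->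
  metrizable R X.
Proof.
move=> dxx dpos dsym dtri nbhs_d.
have [M [f [g [fK gK mdist_f]]]] := metricType_of_dist dxx dpos dsym dtri.
exists M, f; split.
  move=> x U; rewrite -nbhs_ballE => -[r /= r0 rU]; apply/nbhs_d.
  by exists r => // y dxy; apply: rU; rewrite ballEmdist /= mdist_f.
exists g; split=> // y U /nbhs_d[r r0 rU].
rewrite /= -nbhs_ballE; exists r => // z; rewrite ballEmdist /= => yz.
by apply: rU; rewrite -mdist_f !gK.
Qed.

(** A uniformity with a countable base is induced by a pseudometric, given by its
    balls; [edist], the infimum of the radii of the balls around [x] that
    contain [y], is finite because the balls of radius 2 are the whole space,
    and it separates points because the space is T1. *)
Lemma metrizable_countable_uniformity (R : realType) (U : uniformType) :
  accessible_space U -> countable_uniformity U -> metrizable R U.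
Proof.
move=> U_T1 U_cnt.
pose M : pseudoMetricType R := countable_uniform.type U_cnt.
have fin (x y : M) : edist (x, y) \is a fin_num.
  apply/edist_finP; exists 2%R => //.
  exact: countable_uniform.countable_uniform_bounded.
have nbhs_edist (x : M) (V : set M) : nbhs x V <->
    exists2 r : R, (0 < r)%R & forall y, (fine (edist (x, y)) < r)%R -> V y.
  rewrite -nbhs_ballE; split=> -[r /= r0 rV].
  - exists r => // y; rewrite -lte_fin fineK// => /edist_lt_ball; exact: rV.
  (* Halving the radius makes the bound [edist <= r / 2] a strict one below r. *)
  - exists (r / 2)%R => [/=|y xy]; first by rewrite divr_gt0.
    apply: rV; rewrite -lte_fin fineK//.
    have /(@edist_fin _ _ _ (x, y)) := xy.
    rewrite divr_gt0// => /(_ isT) /le_lt_trans; apply.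
    by rewrite lte_fin gtr_pMr// invf_lt1// ltr1n.
apply: (@metrizable_dist R U (fun x y => fine (edist (x : M, y : M)))).
- by move=> x; rewrite edist_refl.
- move=> x y xy0; apply/eqP/negPn/negP => /U_T1 [A [oA /set_mem Ax /set_mem]].
  apply; have /nbhs_edist[r r0] : nbhs (x : M) A by exact: open_nbhs_nbhs.
  by apply; rewrite xy0.
- by move=> x y; rewrite edist_sym.
- by move=> y x z; rewrite -lee_fin EFinD !fineK//; exact: edist_triangle.
- by move=> x V; rewrite nbhs_edist.
Qed.

(** As each [D k] contains the diagonal, the inclusions
    [D k.+1 \; D k.+1 <= D k] also make [D] decreasing, so that its members are
    a filter base, and therefore a countable base of a uniformity. *)
Lemma metrizable_entourage_sequence (R : realType) (X : topologicalType)
    (D : nat -> set (X * X)) :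
  accessible_space X ->
  (forall k x, D k (x, x)) ->
  (forall k a b, D k (a, b) -> D k (b, a)) ->
  (forall k, (D k.+1 \; D k.+1)%relation `<=` D k) ->
  (forall x (U : set X),
     nbhs x U <-> exists k, forall y, D k (x, y) -> U y) ->
  metrizable R X.
Proof.
move=> X_T1 D_refl D_sym D_comp nbhs_D.
have D_decr k l : k <= l -> D l `<=` D k.
  move=> /subnK <-; elim: (l - k) => //= n IHn [a b] Dab.
  by apply/IHn/D_comp; exists b.
pose ent : set_system (X * X) := filter_from setT D.
have ent_filter : Filter ent.
  apply: filter_from_filter; first by exists 0.
  move=> k l _ _; exists (maxn k l) => // ab Dab.
  by split; apply: D_decr Dab; rewrite (leq_maxl, leq_maxr).
have ent_diag A : ent A -> diagonal `<=` A.
  by move=> [k _ DA] [a b] /= ab; apply: DA; have <- : a = b.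
have ent_inv A : ent A -> ent (A^-1)%relation.
  by move=> [k _ DA]; exists k => // -[a b] /D_sym/DA.
have ent_split A : ent A -> exists2 B, ent B & (B \; B)%relation `<=` A.
  move=> [k _ DA]; exists (D k.+1); first by exists k.+1.
  exact: subset_trans (D_comp k) DA.
have nbhs_ent : nbhs = nbhs_ ent.
  apply/funext => x; apply/seteqP; split=> U.
    move=> /nbhs_D[k DU]; exists (D k); first by exists k.
    by move=> y /set_mem/DU.
  move=> [A [k _ DA] AU]; apply/nbhs_D; exists k => y Dxy.
  exact/AU/mem_set/DA.
pose entX := Nbhs_isUniform_mixin.Build X
  ent_filter ent_diag ent_inv ent_split nbhs_ent.
pose U : uniformType := HB.pack (Topological.sort X) entX.
apply: (@metrizable_countable_uniformity R U) => //.
apply/countable_uniformityP; exists D.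
  by move=> A [k _ DA]; exists k.
by move=> k; exists k.
Qed.

(** * Frink's metrization theorem *)

(** The index that makes the neighborhoods [V n y] meeting [V n x] small may
    depend on [x].  Iterating it along each point gives neighborhoods [W k x]
    whose depth [r k x] varies with [x], and for which the dependence disappears:
    if [W k.+1 x] meets [W k.+1 y], then the shallower of the two points, say
    [x], has the relevant index for both, so that both sets lie in [W k x].
    Hence the relations of lying in a common [W k x] compose as entourages
    should. *)
Lemma metrizable_frink (R : realType) (X : topologicalType)
    (V : nat -> X -> set X) :
  accessible_space X ->
  (forall x n m, n <= m -> V m x `<=` V n x) ->
  (forall n x, nbhs x (V n x)) ->
  (forall x U, nbhs x U -> exists n, forall y,
     V n x `&` V n y !=set0 -> V n y `<=` U) ->
  metrizable R X.
Proof.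
move=> X_T1 V_anti V_nbhs V_frink.
have Vx n x : V n x x by exact: nbhs_singleton.
have /choice[m m_spec] : forall xn : X * nat, exists m, xn.2 < m /\
    forall y, V m xn.1 `&` V m y !=set0 -> V m y `<=` V xn.2 xn.1.
  move=> [x n] /=; have [k Vk] := V_frink x _ (V_nbhs n x).
  have lek : k <= maxn k n.+1 by rewrite leq_maxl.
  (* Requiring n < m forces r k x >= k below, so that W k x shrinks to x. *)
  exists (maxn k n.+1); split=> [|y [z [Vxz Vyz]]]; first by rewrite leq_maxr.
  apply: subset_trans (V_anti _ _ _ lek) _; apply: Vk.
  by exists z; split; exact: V_anti lek _ _.
pose r k x := iter k (fun n => m (x, n)) 0.
have r_ge k x : k <= r k x.
  elim: k => //= k IHk; apply: leq_ltn_trans IHk _.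
  by have [] := m_spec (x, r k x).
pose W k x := V (r k x) x.
have W_decr k x : W k.+1 x `<=` W k x.
  by apply: V_anti; rewrite ltnW//; have [] := m_spec (x, r k x).
have absorb k x y : r k.+1 x <= r k.+1 y ->
    W k.+1 x `&` W k.+1 y !=set0 -> W k.+1 y `<=` W k x.
  move=> lexy [z [Wxz Wyz]]; apply: subset_trans (V_anti _ _ _ lexy) _.
  have [_] := m_spec (x, r k x); apply.
  by exists z; split=> //; exact: V_anti lexy _ _.
pose D k : set (X * X) := [set ab | exists2 x, W k x ab.1 & W k x ab.2].
apply: (@metrizable_entourage_sequence R X D X_T1).
- by move=> k x; exists x; exact: Vx.
- by move=> k a b [x Wa Wb]; exists x.
- move=> k [a c] [b [x /= Wxa Wxb] [y /= Wyb Wyc]].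
  have [lexy|/ltnW leyx] := leqP (r k.+1 x) (r k.+1 y).
    exists x => /=; first exact: W_decr.
    by apply: (absorb _ x y) => //; exists b.
  exists y => /=; last exact: W_decr.
  by apply: (absorb _ y x) => //; exists b.
- move=> x U; split=> [/V_frink[k Vk]|[k DU]].
    exists k => b [y /= Wyx Wyb].
    have WV : W k y `<=` V k y by exact: V_anti (r_ge k y).
    by apply: (Vk y); [exists x; split=> //; exact: WV|exact: WV].
  apply: filterS (V_nbhs (r k x) x) => b Wb.
  by apply: DU; exists x => //; exact: Vx.
Qed.

(** * Bisequentiality and first countability *)

(** A set meeting all dense open sets is somewhere dense, since otherwise the
    complement of its closure would be a dense open set that it misses.  So a
    countable prefilter that is synchronous with the dense open sets and
    converges to [x] yields open sets: the interiors of the closures of its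
    members.  Regularity keeps them converging to [x]. *)
Lemma bisequential_pi_sequence (X : topologicalType) (x : X) :
  regular_space X -> bisequential X ->
  exists O : nat -> set X,
    (forall n, open (O n) /\ O n !=set0) /\
    (forall U, nbhs x U -> exists n, O n `<=` U).
Proof.
move=> X_reg X_bis.
pose zeta : set (set X) := [set D | open D /\ dense D].
have zeta_dense D : zeta D -> closure D = setT.
  move=> [_ Dd]; apply/seteqP; split=> // y _ B.
  rewrite nbhsE => -[C [oC Cy] CB].
  have [|z [Cz Dz]] := Dd C _ oC; first by exists y.
  by exists z; split=> //; exact: CB.
have zeta_prefilter : prefilter zeta.
  split=> [D [_ Dd]|D E [oD dD] [oE dE]].
    by have [|y [_ Dy]] := Dd setT _ openT; [exists x | exists y].
  by exists (D `&` E) => //; split; [exact: openI | exact: denseI].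
have zeta_x : adheres_to zeta x by move=> D /zeta_dense ->.
have [xi [xi_cnt _ xi_x zeta_xi]] := X_bis _ _ zeta_prefilter zeta_x.
have xi_fat A : xi A -> (closure A)° !=set0.
  move=> xiA; apply: contrapT => clA0.
  have zetaCA : zeta (~` closure A).
    split; first exact/closed_openC/closed_closure.
    move=> C [y Cy] oC; apply: contrapT => CA; apply: clA0; exists y.
    apply: filterS (open_nbhs_nbhs (conj oC Cy)) => z Cz.
    by apply: contrapT => Az; apply: CA; exists z.
  have [z [CAz Az]] := zeta_xi _ _ zetaCA xiA.
  exact/CAz/subset_closure.
have [xi0|[f]] := pfcard_geP xi_cnt.
  by have [] := xi_x setT (open_nbhsT x); rewrite xi0.
exists (fun n => (closure (f n))°); split=> [n|U /X_reg[C /= Cx CU]].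
  by split; [exact: open_interior | apply/xi_fat/funS].
move: Cx; rewrite nbhsE => -[C' C'x C'C].
have [A xiA AC'] := xi_x _ C'x.
have [n _ fnA] := @surj _ _ _ _ f _ xiA.
exists n; rewrite fnA; apply: subset_trans (@interior_subset _ _) _.
apply: subset_trans CU; apply: closure_subset.
exact: subset_trans C'C.
Qed.

Lemma nested_neighborhood_sequence (X : topologicalType) (x : X)
    (B : nat -> set X) :
  (forall n, nbhs x (B n)) -> (forall U, nbhs x U -> exists n, B n `<=` U) ->
  exists C : nat -> set X,
    [/\ forall n, nbhs x (C n), forall n m, n <= m -> C m `<=` C n &
        forall U, nbhs x U -> exists n, C n `<=` U].
Proof.
move=> B_nbhs B_base.
exists (fun n => \bigcap_(i < n.+1) B i); split=> [n|n m le_nm|U /B_base[n BU]].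
- rewrite bigcap_mkord; apply: big_ind => // [|A A']; first exact: filterT.
  exact: filterI.
- by move=> y By i /= i_le; apply: By => /=; exact: leq_trans le_nm.
- by exists n; apply: subset_trans BU => y; apply => /=.
Qed.

(** * Rectifiable spaces *)

(** The homeomorphism of [G * G] preserves first coordinates, so it and its
    inverse are determined by their second coordinates [q] and [p]. *)
Lemma rectifiable_operations (G : topologicalType) :
  rectifiable G ->
  exists (p q : G -> G -> G) (e : G),
    [/\ continuous (fun z : G * G => p z.1 z.2),
        continuous (fun z : G * G => q z.1 z.2),
        forall x, q x x = e,
        forall x y, p x (q x y) = y & forall x y, q x (p x y) = y].
Proof.
move=> [phi [e [[phi_cts [psi [phiK psiK psi_cts]]] phi1 phi_diag]]].
have psi1 z : (psi z).1 = z.1 by rewrite -phi1 psiK.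
exists (fun x y => (psi (x, y)).2), (fun x y => (phi (x, y)).2), e; split.
- rewrite (_ : (fun z => _) = snd \o psi); last by apply/funext => -[].
  by move=> z; apply: continuous_comp; [exact: psi_cts | exact: cvg_snd].
- rewrite (_ : (fun z => _) = snd \o phi); last by apply/funext => -[].
  by move=> z; apply: continuous_comp; [exact: phi_cts | exact: cvg_snd].
- by move=> x; rewrite phi_diag.
- move=> x y; rewrite (_ : (x, _) = phi (x, y)) ?phiK//.
  by rewrite [RHS]surjective_pairing phi1.
- move=> x y; rewrite (_ : (x, _) = psi (x, y)) ?psiK//.
  by rewrite [RHS]surjective_pairing psi1.
Qed.

Section rectifiable_space.
Context {G : topologicalType} {p q : G -> G -> G} {e : G}.
Hypotheses (p_cts : continuous (fun z : G * G => p z.1 z.2))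
  (q_cts : continuous (fun z : G * G => q z.1 z.2))
  (q_diag : forall x, q x x = e)
  (p_q : forall x y, p x (q x y) = y) (q_p : forall x y, q x (p x y) = y).

(** For [x] in [O n] the slice [q x (O n)] is already a neighborhood of
    [q x x = e], and [q (O n x O n)] is small when [O n] is close to [e], because
    [q] is continuous at [(e, e)], where its value is [e]. *)
Lemma neighborhood_sequence_of_pi_sequence (O : nat -> set G) :
  (forall n, open (O n) /\ O n !=set0) ->
  (forall U : set G, nbhs e U -> exists n, O n `<=` U) ->
  exists B : nat -> set G,
    (forall n, nbhs e (B n)) /\ (forall U, nbhs e U -> exists n, B n `<=` U).
Proof.
move=> O_open O_base.
exists (fun n => [set z | exists x y, [/\ O n x, O n y & q x y = z]]).
split=> [n|U eU].
  have [On [x Ox]] := O_open n.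
  have Opx : nbhs (p x e) (O n).
    by rewrite -(q_diag x) p_q; exact: open_nbhs_nbhs.
  have [[A B] /= [Ax Be] ABO] := @p_cts (x, e) _ Opx.
  apply: filterS Be => z Bz; exists x, (p x z); split=> //.
  by apply: (ABO (x, z)); split=> //; exact: nbhs_singleton.
have Uqee : nbhs (q e e) U by rewrite q_diag.
have [[A B] /= [Ae Be] ABU] := @q_cts (e, e) _ Uqee.
have [n OAB] := O_base _ (filterI Ae Be).
exists n => _ [x [y [/OAB[Ax _] /OAB[_ By] <-]]].
exact: (ABU (x, y)).
Qed.

(** A locally uniform form of continuity of [p] at [(x, e)]: with [u = q y z] the
    point [z = p y u] is close to [x] as soon as [y] is close to [x] and [u] is
    close to [e]. *)
Lemma translate_neighborhood (C : nat -> set G) :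
  (forall U : set G, nbhs e U -> exists n, C n `<=` U) ->
  forall (x : G) (U : set G), nbhs x U -> exists n (W : set G), nbhs x W /\
    forall y z, W y -> C n (q y z) -> U z.
Proof.
move=> C_base x U xU.
have pxe : p x e = x by rewrite -(q_diag x) p_q.
have Upxe : nbhs (p x e) U by rewrite pxe.
have [[A B] /= [Ax Be] ABU] := @p_cts (x, e) _ Upxe.
have [n CB] := C_base _ Be.
exists n, A; split=> // y z Ay /CB Bqyz.
by rewrite -(p_q y z); exact: (ABU (y, q y z)).
Qed.

(** Requiring both [q x y] and [q y x] to be in [C n] replaces an inversion:
    membership of [z] in the neighborhood of [y] can then be read as a small step
    from [z] to [y].  If the neighborhoods of [x] and [y] share [z] and the one
    of [y] contains [w], three small steps from [x] to [z] to [y] to [w] keep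
    [w] near [x]. *)
Lemma metrizable_first_countable_rectifiable (R : realType) (C : nat -> set G) :
  accessible_space G ->
  (forall n, nbhs e (C n)) -> (forall n m, n <= m -> C m `<=` C n) ->
  (forall U : set G, nbhs e U -> exists n, C n `<=` U) ->
  metrizable R G.
Proof.
move=> G_T1 C_nbhs C_decr C_base.
apply: (@metrizable_frink R G (fun n x => [set y | C n (q x y) /\ C n (q y x)])).
- by [].
- by move=> x n m /C_decr lenm y [Cxy Cyx]; split; exact: lenm.
- move=> n x.
  have Cqxx : nbhs (q x x) (C n) by rewrite q_diag.
  have [[A B] /= [Ax Bx] ABC] := @q_cts (x, x) _ Cqxx.
  apply: filterS (filterI Ax Bx) => y [Ay By].
  split; first by apply: (ABC (x, y)); split=> //; exact: nbhs_singleton.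
  by apply: (ABC (y, x)); split=> //; exact: nbhs_singleton.
- move=> x U xU.
  have [n1 [W1 [xW1 W1U]]] := translate_neighborhood C_base xU.
  have [n2 [W2 [xW2 W2W1]]] := translate_neighborhood C_base xW1.
  have [n3 [W3 [xW3 W3W2]]] := translate_neighborhood C_base xW2.
  pose m := maxn n1 (maxn n2 n3).
  have [le1 le2 le3] : [/\ n1 <= m, n2 <= m & n3 <= m].
    by rewrite /m !leq_max !leqnn !orbT.
  exists m => y [z [[Cxz _] [_ Czy]]] w [Cyw _].
  apply: (W1U y); last exact: C_decr le1 _ _.
  apply: (W2W1 z); last exact: C_decr le2 _ _.
  apply: (W3W2 x); last exact: C_decr le3 _ _.
  exact: nbhs_singleton.
Qed.
End rectifiable_space.

Theorem theorem3p3 (R : realType) (G : topologicalType)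
    (G_T1 : @accessible_space G) (G_regular : regular_space G)
    (G_rectifiable : rectifiable G) (G_bisequential : bisequential G) :
  metrizable R G.
Proof.
have [p [q [e [p_cts q_cts q_diag p_q q_p]]]] :=
  rectifiable_operations G_rectifiable.
have [O [O_open O_base]] := bisequential_pi_sequence e G_regular G_bisequential.
have [B [B_nbhs B_base]] := neighborhood_sequence_of_pi_sequence
  p_cts q_cts q_diag p_q q_p O_open O_base.
have [C [C_nbhs C_decr C_base]] := nested_neighborhood_sequence B_nbhs B_base.
exact: (metrizable_first_countable_rectifiable p_cts q_cts q_diag p_q R
  G_T1 C_nbhs C_decr C_base).
Qed.
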